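(* Let $G$ be a topological group and let $N$ be a closed normal subgroup of $G$. If both $N$ (with the subspace topology) and $G/N$ (with the quotient topology) are TNA, then $G$ is TNA.
   Context: All topological groups are assumed to be Hausdorff. A topological group is topologically non-Archimedean (TNA) if every neighborhood of the neutral element contains an open subgroup. *)

(* Defs.v *)
From HB Require Import structures.
From mathcomp Require Import all_boot.
From mathcomp Require Import all_classical.
From mathcomp Require Import topology.

Set Implicit Arguments.
Unset Strict Implicit.
Unset Printing Implicit Defensive.


Local Open Scope classical_set_scope.
Local Open Scope quotient_scope.
Local Open Scope group_scope.

(* Topological groups are Hausdorff by convention. *)
HB.mixin Record isTopologicalGroup G of Group G & Topological G := {
  mulg_continuous : continuous (fun xy : G * G => xy.1 * xy.2);
  invg_continuous : continuous (fun x : G => x^-1);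
  topgroup_hausdorff : hausdorff_space G
}.

#[short(type="topologicalGroupType")]
HB.structure Definition TopologicalGroup :=
  {G of isTopologicalGroup G & Group G & Topological G}.

Definition subgroup (G : groupType) (H : set G) : Prop :=
  [/\ H 1, (forall x y, H x -> H y -> H (x * y))
    & (forall x, H x -> H x^-1)].

Definition normal_subgroup (G : groupType) (N : set G) : Prop :=
  subgroup N /\ (forall x g, N x -> N (x ^ g)).

Definition topologically_non_archimedean (G : topologicalGroupType) : Prop :=
  forall U : set G, nbhs 1 U ->
    exists H : set G, [/\ open H, subgroup H & H `<=` U].

Record closedNormalSubgroup (G : topologicalGroupType) := ClosedNormalSubgroup {
  cns_set :> set G;
  cns_normal : normal_subgroup cns_set;
  cns_closed : closed cns_set
}.

Lemma continuous_mulg (G : topologicalGroupType) (T : topologicalType)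
    (f g : T -> G) :
  continuous f -> continuous g -> continuous (fun t => f t * g t).
Proof.
move=> cf cg t; apply: (@continuous_comp _ _ _
  (fun t => (f t, g t)) (fun xy : G * G => xy.1 * xy.2)).
  by apply: cvg_pair; [exact: cf|exact: cg].
exact: mulg_continuous.
Qed.

Lemma continuous_invg (G : topologicalGroupType) (T : topologicalType)
    (f : T -> G) : continuous f -> continuous (fun t => (f t)^-1).
Proof.
move=> cf t; apply: (@continuous_comp _ _ _ f (fun x : G => x^-1)).
  exact: cf.
exact: invg_continuous.
Qed.

Section Subgroup.
Context {G : topologicalGroupType} (N : closedNormalSubgroup G).

Lemma cns1 : cns_set N 1. Proof. by case: (cns_normal N) => -[]. Qed.
Lemma cnsM x y : cns_set N x -> cns_set N y -> cns_set N (x * y).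
Proof. by case: (cns_normal N) => -[_ + _] _; apply. Qed.
Lemma cnsV x : cns_set N x -> cns_set N x^-1.
Proof. by case: (cns_normal N) => -[_ _ +] _; apply. Qed.
Lemma cnsJ x g : cns_set N x -> cns_set N (x ^ g).
Proof. by case: (cns_normal N) => _; apply. Qed.

(* [set_type] carries the subspace topology. *)
Definition subgroup_type : Type := set_type N.

HB.instance Definition _ := Topological.copy subgroup_type (set_type N).

Definition subgroup_val (x : subgroup_type) : G := set_val x.

Lemma subgroup_val_inj : injective subgroup_val.
Proof. exact: val_inj. Qed.

Lemma subgroup_valP (x : subgroup_type) : cns_set N (subgroup_val x).
Proof. exact: set_valP. Qed.

Definition subgroup_one : subgroup_type := SigSub (mem_set cns1).
Definition subgroup_mul (x y : subgroup_type) : subgroup_type :=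
  SigSub (mem_set (cnsM (subgroup_valP x) (subgroup_valP y))).
Definition subgroup_inv (x : subgroup_type) : subgroup_type :=
  SigSub (mem_set (cnsV (subgroup_valP x))).

Lemma subgroup_mulA : associative subgroup_mul.
Proof. by move=> x y z; apply: subgroup_val_inj; exact: mulgA. Qed.
Lemma subgroup_mul1 : left_id subgroup_one subgroup_mul.
Proof. by move=> x; apply: subgroup_val_inj; exact: mul1g. Qed.
Lemma subgroup_1mul : right_id subgroup_one subgroup_mul.
Proof. by move=> x; apply: subgroup_val_inj; exact: mulg1. Qed.
Lemma subgroup_mulV : left_inverse subgroup_one subgroup_inv subgroup_mul.
Proof. by move=> x; apply: subgroup_val_inj; exact: mulVg. Qed.
Lemma subgroup_Vmul : right_inverse subgroup_one subgroup_inv subgroup_mul.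
Proof. by move=> x; apply: subgroup_val_inj; exact: mulgV. Qed.

HB.instance Definition _ := isGroup.Build subgroup_type
  subgroup_mulA subgroup_mul1 subgroup_1mul subgroup_mulV subgroup_Vmul.

Lemma subgroup_val_continuous : continuous subgroup_val.
Proof. exact: initial_continuous. Qed.

Lemma subgroup_cvg (T : topologicalType) (f : T -> subgroup_type) :
  continuous (subgroup_val \o f) -> continuous f.
Proof.
move=> /continuousP cf; apply/continuousP => _ [B oB <-].
by rewrite -comp_preimage; exact: cf.
Qed.

Lemma subgroup_mulg_continuous :
  continuous (fun xy : subgroup_type * subgroup_type => xy.1 * xy.2).
Proof.
apply: subgroup_cvg.
apply: (@continuous_mulg _ _ (fun xy => subgroup_val xy.1)
  (fun xy => subgroup_val xy.2)) => -[x y].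
  apply: (@continuous_comp _ _ _ fst subgroup_val); first exact: cvg_fst.
  exact: subgroup_val_continuous.
apply: (@continuous_comp _ _ _ snd subgroup_val); first exact: cvg_snd.
exact: subgroup_val_continuous.
Qed.

Lemma subgroup_invg_continuous : continuous (fun x : subgroup_type => x^-1).
Proof.
apply: subgroup_cvg; apply: (@continuous_invg _ _ subgroup_val).
exact: subgroup_val_continuous.
Qed.

Lemma subgroup_hausdorff : hausdorff_space subgroup_type.
Proof.
move=> x y xy; apply: subgroup_val_inj.
apply: (@topgroup_hausdorff G) => A B xA yB.
have [z [zA zB]] :=
  xy _ _ (subgroup_val_continuous xA) (subgroup_val_continuous yB).
by exists (subgroup_val z).
Qed.

HB.instance Definition _ := isTopologicalGroup.Build subgroup_type
  subgroup_mulg_continuous subgroup_invg_continuous subgroup_hausdorff.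

End Subgroup.

Section Quotient.
Context {G : topologicalGroupType} (N : closedNormalSubgroup G).

Definition coset_rel (x y : G) : bool := x^-1 * y \in (N : set G).

Lemma coset_relP x y : reflect (cns_set N (x^-1 * y)) (coset_rel x y).
Proof. exact: asboolP. Qed.

Lemma coset_rel_equiv : equiv_class_of coset_rel.
Proof.
split=> [x|x y|y x z].
- by apply/coset_relP; rewrite mulVg; exact: cns1.
- by apply/coset_relP/coset_relP => /cnsV; rewrite invgM invgK.
- move=> /coset_relP xy /coset_relP yz; apply/coset_relP.
  by have := cnsM xy yz; rewrite -mulgA mulVKg.
Qed.

Canonical coset_equiv := EquivRelPack coset_rel_equiv.

(* G/N with the quotient topology: U is open iff its preimage in G is. *)
Definition quotient_group : Type := quotient_topology {eq_quot coset_equiv}.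

HB.instance Definition _ := Topological.copy quotient_group
  (quotient_topology {eq_quot coset_equiv}).
HB.instance Definition _ := Quotient.copy quotient_group
  (quotient_topology {eq_quot coset_equiv}).

Definition quotient_proj (x : G) : quotient_group := \pi_quotient_group x.

Lemma quotient_projP x y :
  quotient_proj x = quotient_proj y <-> cns_set N (x^-1 * y).
Proof.
split=> [/(@eqquotP _ coset_equiv)|] h.
  by apply/coset_relP; exact: h.
by apply/(@eqquotP _ coset_equiv); exact/coset_relP.
Qed.

Lemma quotient_proj_repr (p : quotient_group) : quotient_proj (repr p) = p.
Proof. exact: reprK. Qed.

Definition quotient_one : quotient_group := quotient_proj 1.
Definition quotient_mul (p q : quotient_group) : quotient_group :=
  quotient_proj (repr p * repr q).
Definition quotient_inv (p : quotient_group) : quotient_group :=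
  quotient_proj (repr p)^-1.

Lemma quotient_mulE x y :
  quotient_mul (quotient_proj x) (quotient_proj y) = quotient_proj (x * y).
Proof.
apply/quotient_projP.
have /quotient_projP hx := quotient_proj_repr (quotient_proj x).
have /quotient_projP hy := quotient_proj_repr (quotient_proj y).
move: (repr _) (repr _) hx hy => b a hx hy.
have := cnsM (cnsJ b hx) hy.
by rewrite /conjg invgM !mulgA mulgK.
Qed.

Lemma quotient_invE x : quotient_inv (quotient_proj x) = quotient_proj x^-1.
Proof.
apply/quotient_projP.
have /quotient_projP := quotient_proj_repr (quotient_proj x).
move: (repr _) => a /cnsV /(cnsJ a^-1).
by rewrite /conjg invgM !invgK !mulgA mulgK.
Qed.

Lemma quotient_mulA : associative quotient_mul.
Proof.
move=> p q r; rewrite -(quotient_proj_repr p) -(quotient_proj_repr q).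
by rewrite -(quotient_proj_repr r) !quotient_mulE mulgA.
Qed.
Lemma quotient_mul1 : left_id quotient_one quotient_mul.
Proof.
by move=> p; rewrite -(quotient_proj_repr p) quotient_mulE mul1g.
Qed.
Lemma quotient_1mul : right_id quotient_one quotient_mul.
Proof.
by move=> p; rewrite -(quotient_proj_repr p) quotient_mulE mulg1.
Qed.
Lemma quotient_mulV : left_inverse quotient_one quotient_inv quotient_mul.
Proof.
move=> p; rewrite -(quotient_proj_repr p) quotient_invE quotient_mulE.
by rewrite mulVg.
Qed.
Lemma quotient_Vmul : right_inverse quotient_one quotient_inv quotient_mul.
Proof.
move=> p; rewrite -(quotient_proj_repr p) quotient_invE quotient_mulE.
by rewrite mulgV.
Qed.

HB.instance Definition _ := isGroup.Build quotient_group
  quotient_mulA quotient_mul1 quotient_1mul quotient_mulV quotient_Vmul.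

Lemma quotient_proj_continuous : continuous quotient_proj.
Proof. exact: pi_continuous. Qed.

Lemma quotient_proj_nbhs (x : G) (A : set G) :
  nbhs x A -> nbhs (quotient_proj x) (quotient_proj @` A).
Proof.
rewrite nbhsE => -[O [oO Ox] OA].
suff oQ : open (quotient_proj @` O).
  apply: (filterS (P := quotient_proj @` O)); first exact: image_subset.
  by apply: open_nbhs_nbhs; split=> //; exists x.
change (open (quotient_proj @^-1` (quotient_proj @` O))).
rewrite openE => z [u Ou /esym /quotient_projP zu] /=.
have cz : continuous (fun w : G => w * (z^-1 * u)).
  apply: (@continuous_mulg _ _ id (fun=> z^-1 * u)) => w.
    exact: cvg_id.
  exact: cvg_cst.
have : nbhs z ((fun w : G => w * (z^-1 * u)) @^-1` O).
  by apply: cz; apply: open_nbhs_nbhs; split=> //; rewrite mulVKg.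
apply: filterS => w /= Ow; exists (w * (z^-1 * u)) => //.
by apply/esym/quotient_projP; rewrite mulKg.
Qed.

Lemma quotient_mulg_continuous :
  continuous (fun pq : quotient_group * quotient_group => pq.1 * pq.2).
Proof.
move=> -[p q] W; rewrite -(quotient_proj_repr p) -(quotient_proj_repr q) /=.
move: (repr p) (repr q) => a b.
have -> : quotient_proj a * quotient_proj b = quotient_proj (a * b).
  exact: quotient_mulE.
move=> /quotient_proj_continuous.
move=> /(@mulg_continuous G (a, b)) [[A B] /= [aA bB] AB].
exists (quotient_proj @` A, quotient_proj @` B).
  by split; exact: quotient_proj_nbhs.
move=> [_ _] [/= [u Au <-] [v Bv <-]].
have -> : quotient_proj u * quotient_proj v = quotient_proj (u * v).
  exact: quotient_mulE.
exact: (AB (u, v)).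
Qed.

Lemma quotient_invg_continuous : continuous (fun p : quotient_group => p^-1).
Proof.
move=> p W; rewrite -(quotient_proj_repr p); move: (repr p) => a.
have -> : (quotient_proj a)^-1 = quotient_proj a^-1 by exact: quotient_invE.
move=> /quotient_proj_continuous /(@invg_continuous G a) /quotient_proj_nbhs.
apply: filterS => _ [u Wu <-] /=.
by have -> : (quotient_proj u)^-1 = quotient_proj u^-1 by exact: quotient_invE.
Qed.

Lemma quotient_hausdorff : hausdorff_space quotient_group.
Proof.
move=> p q; rewrite -(quotient_proj_repr p) -(quotient_proj_repr q).
move: (repr p) (repr q) => a b ab; apply/quotient_projP; apply: contrapT => nab.
have cf : continuous (fun xy : G * G => xy.1^-1 * xy.2).
  apply: (@continuous_mulg _ _ (fun xy => xy.1^-1) snd) => [|[x y]].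
    by apply: (@continuous_invg _ _ fst) => -[x y]; exact: cvg_fst.
  exact: cvg_snd.
have : nbhs (a^-1 * b) (~` N).
  by apply: open_nbhs_nbhs; split=> //; apply: closed_openC; exact: cns_closed.
move=> /(cf (a, b)) [[A B] /= [aA bB] AB].
have [_ [[u Au <-] [v Bv /esym /quotient_projP uv]]] :=
  ab _ _ (quotient_proj_nbhs aA) (quotient_proj_nbhs bB).
exact: (AB (u, v)).
Qed.

HB.instance Definition _ := isTopologicalGroup.Build quotient_group
  quotient_mulg_continuous quotient_invg_continuous quotient_hausdorff.

End Quotient.

(* Main.v *)
From mathcomp Require Import all_boot.
From mathcomp Require Import all_classical.
From mathcomp Require Import topology.
Require Import Defs.

(** Write [pi] for the projection of [G] onto [G/N].  Inside a neighborhood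
    [U] of [1], an open subgroup is found as the stabilizer of a small set,
    which avoids any conjugation: elements of [G] close to [1] need not
    normalize the small open subgroups of [N].

    Choose [V] with [V V] in [U], and let [M] be an open subgroup of [N]
    contained in [V]; write [M] as the trace on [N] of an open set [B]
    ([tna_subgroup_trace]).  Choose
    a symmetric neighborhood [W] of [1], contained in [V], with [W W W] in [B],
    and an open subgroup [Q] of [G/N] inside [pi W].  Put [S = W /\ pi^-1 Q], a
    symmetric neighborhood of [1].  For [s] and [t] in [S] the class of [s t]
    is in [Q], hence is the class of some [w] in [W]; this [w] lies in [S], and
    [w^-1 s t] lies in [N] ([tna_quotient_factor]) and in [W W W], hence in
    [M].  So [S S] is contained
    in [S M], and therefore [S (S M)] is contained in [S M]: the set [S M] is
    stable under left translations by [S].  Its left stabilizer [H] is then a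
    subgroup containing the neighborhood [S], so it is open
    ([subgroup_nbhs1_open]), and [H], which moves [1] inside [S M], is contained
    in [S M], hence in [V V] and in [U]. *)

Local Open Scope classical_set_scope.
Local Open Scope group_scope.

Lemma nbhs1_mul {G : topologicalGroupType} (U : set G) : nbhs 1 U ->
  exists2 V : set G, nbhs 1 V & forall x y, V x -> V y -> U (x * y).
Proof.
move=> U1; have : nbhs ((1 : G) * 1) U by rewrite mulg1.
move=> /(@mulg_continuous G (1, 1)) [[A B] /= [A1 B1] AB].
exists (A `&` B); first exact: filterI.
by move=> x y [Ax _] [_ By]; exact: (AB (x, y)).
Qed.

Lemma nbhs1_inv {G : topologicalGroupType} (U : set G) :
  nbhs 1 U -> nbhs 1 [set x : G | U x^-1].
Proof.
move=> U1; have : nbhs (1 : G)^-1 U by rewrite invg1.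
exact: (@invg_continuous G 1).
Qed.

Lemma nbhs1_symmetric_cube {G : topologicalGroupType} (U : set G) :
  nbhs 1 U -> exists W : set G, [/\ nbhs 1 W, forall x, W x -> W x^-1 &
    forall x y z, W x -> W y -> W z -> U (x * y * z)].
Proof.
move=> /nbhs1_mul[V V1 VU]; have [W W1 WV] := nbhs1_mul _ V1.
pose A := W `&` V.
have A1 : nbhs 1 A by exact: filterI.
exists (A `&` [set x | A x^-1]); split.
- by apply: filterI => //; exact: nbhs1_inv.
- by move=> x [Ax AVx]; split=> //=; rewrite invgK.
- by move=> x y z [[Wx _] _] [[Wy _] _] [[_ Vz] _]; apply: VU => //; exact: WV.
Qed.

(** A subgroup [H] is a neighborhood of each [x] in [H] because it is the left
    translate of itself by [x]. *)
Lemma subgroup_nbhs1_open {G : topologicalGroupType} (H : set G) :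
  subgroup H -> nbhs 1 H -> open H.
Proof.
move=> [_ HM _] H1; rewrite openE => x Hx /=.
have cx : continuous (fun y : G => x^-1 * y).
  by apply: (@continuous_mulg _ _ (fun=> x^-1) id) => y;
    [exact: cvg_cst|exact: cvg_id].
have : nbhs x ((fun y : G => x^-1 * y) @^-1` H) by apply: cx; rewrite mulVg.
apply: filterS => y /= Hy.
by rewrite -(mulVKg x y); exact: HM.
Qed.

(** The equivalence, instead of an implication, is what makes the stabilizer of
    an infinite set closed under inverses. *)
Definition left_stabilizer {G : groupType} (T : set G) : set G :=
  [set x | forall y, T (x * y) <-> T y].

Lemma left_stabilizer_subgroup {G : groupType} (T : set G) :
  subgroup (left_stabilizer T).
Proof.
split=> [y|x z Tx Tz y|x Tx y]; first by rewrite mul1g.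
  by rewrite -mulgA; split=> [/Tx/Tz|/Tz/Tx].
by rewrite -(Tx (x^-1 * y)) mulVKg.
Qed.

Lemma left_stabilizer_sub {G : groupType} (T : set G) :
  T 1 -> left_stabilizer T `<=` T.
Proof. by move=> T1 x /(_ 1); rewrite mulg1 => /iffRL; exact. Qed.

Lemma sub_left_stabilizer {G : groupType} (S T : set G) :
  (forall x, S x -> S x^-1) -> (forall x y, S x -> T y -> T (x * y)) ->
  S `<=` left_stabilizer T.
Proof.
move=> SV ST x Sx y; split; last exact: ST.
by move=> Txy; rewrite -(mulKg x y); apply: ST => //; exact: SV.
Qed.

(** Open subgroups of [N] are traces on [N] of open subsets of [G]. *)
Lemma tna_subgroup_trace {G : topologicalGroupType} (N : closedNormalSubgroup G)
    (V : set G) :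
  topologically_non_archimedean (subgroup_type N) -> nbhs 1 V ->
  exists B : set G,
    [/\ nbhs 1 B, subgroup (cns_set N `&` B) & cns_set N `&` B `<=` V].
Proof.
move=> hN V1.
have /hN[M [[B oB BM] [M1 MM MV] Msub]] :
    nbhs (1 : subgroup_type N) (@subgroup_val G N @^-1` V).
  exact: (@subgroup_val_continuous G N 1).
have inM (x : G) (Nx : cns_set N x) (Bx : B x) :
    exists2 m : subgroup_type N, M m & subgroup_val m = x.
  by exists (SigSub (mem_set Nx)) => //; rewrite -BM.
have Mval (m : subgroup_type N) : M m -> (cns_set N `&` B) (subgroup_val m).
  by rewrite -BM => Bm; split=> //; exact: subgroup_valP.
exists B; split.
- by apply: open_nbhs_nbhs; split=> //; have [] := Mval _ M1.
- split; first exact: (Mval _ M1).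
    move=> x y [Nx Bx] [Ny By].
    have [m Mm <-] := inM x Nx Bx; have [n Mn <-] := inM y Ny By.
    exact: (Mval _ (MM _ _ Mm Mn)).
  move=> x [Nx Bx]; have [m Mm <-] := inM x Nx Bx.
  exact: (Mval _ (MV _ Mm)).
- by move=> x [Nx Bx]; have [m Mm <-] := inM x Nx Bx; exact: Msub.
Qed.

(** The factor [w] can be taken in [S], and not merely in [W], because it has
    the class of [s * t], which lies in an open subgroup of the quotient. *)
Lemma tna_quotient_factor {G : topologicalGroupType}
    (N : closedNormalSubgroup G) (W : set G) :
  topologically_non_archimedean (quotient_group N) ->
  nbhs 1 W -> (forall x, W x -> W x^-1) ->
  exists S : set G, [/\ nbhs 1 S, S `<=` W, (forall x, S x -> S x^-1) &
    forall s t, S s -> S t -> exists2 w, S w & cns_set N (w^-1 * (s * t))].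
Proof.
move=> hGN W1 WV.
have /hGN[Q [oQ [Q1 QM QV] QW]] : nbhs (1 : quotient_group N) (quotient_proj N @` W).
  exact: quotient_proj_nbhs.
exists (W `&` quotient_proj N @^-1` Q); split.
- apply: filterI => //; apply: (@quotient_proj_continuous G N 1).
  by apply: open_nbhs_nbhs; split.
- by move=> x [].
- move=> x [Wx Qx]; split; first exact: WV.
  by rewrite /= -quotient_invE; exact: QV.
- move=> s t [_ Qs] [_ Qt].
  have Qst : Q (quotient_proj N (s * t)) by rewrite -quotient_mulE; exact: QM.
  have [w Ww wst] := QW _ Qst.
  by exists w; [split=> //=; rewrite wst|exact/quotient_projP].
Qed.

Theorem theorem2p7 (G : topologicalGroupType) (N : closedNormalSubgroup G)
  (hN : topologically_non_archimedean (subgroup_type N))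
  (hGN : topologically_non_archimedean (quotient_group N)) :
  topologically_non_archimedean G.
Proof.
move=> U /nbhs1_mul[V V1 VU].
have [B [B1 [M1 MM _] MV]] := tna_subgroup_trace N V hN V1.
have [W [W1 WV WB]] := nbhs1_symmetric_cube _ (filterI B1 V1).
have Wid : W 1 by exact: nbhs_singleton.
have W_sub x : W x -> V x.
  by move=> Wx; have [] := WB 1 1 x Wid Wid Wx; rewrite !mul1g.
have [S [S1 SW SV SS]] := tna_quotient_factor N W hGN W1 WV.
pose T := [set x | exists s m, [/\ S s, (cns_set N `&` B) m & x = s * m]].
have T1 : T 1 by exists 1, 1; split; [exact: nbhs_singleton| |rewrite mulg1].
have ST x y : S x -> T y -> T (x * y).
  move=> Sx [t [m [St Mm ->]]]; have [w Sw Nw] := SS x t Sx St.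
  exists w, (w^-1 * (x * t) * m); split=> //; last by rewrite !mulgA mulgV mul1g.
  apply: MM => //; split=> //; rewrite mulgA.
  by have [] := WB w^-1 x t (WV _ (SW _ Sw)) (SW _ Sx) (SW _ St).
have TU : T `<=` U.
  by move=> _ [s [m [/SW/W_sub Vs /MV Vm ->]]]; exact: VU.
exists (left_stabilizer T); split.
- apply: subgroup_nbhs1_open; first exact: left_stabilizer_subgroup.
  by apply: filterS S1; exact: sub_left_stabilizer.
- exact: left_stabilizer_subgroup.
- by apply: subset_trans TU; exact: left_stabilizer_sub.
Qed.
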